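(* Let $r\ge1$ and let $G=\overline{\langle a_1,\dots,a_r\rangle}\subset W$ be the closed subgroup topologically generated by the elements $a_1,\dots,a_r\in W$ determined by $a_1=(a_r,1)\,\sigma$ and $a_i=(a_{i-1},1)$ for $2\le i\le r$. For $1\le i\le r$ let $H^{(i)}$ be the closure of the subgroup of $G$ generated by all $G$-conjugates of $a_j$ for all $j\neq i$. Then the closure of the commutator subgroup of $G$ is $H^{(1)}\cap\dots\cap H^{(r)}$, and the maximal profinite abelian factor group of $G$ is $$G_{\mathrm{ab}}=G/(H^{(1)}\cap\dots\cap H^{(r)})\ \xrightarrow{\ \sim\ }\ G/H^{(1)}\times\dots\times G/H^{(r)}\ \cong\ \mathbb{Z}_2^r,$$ where the first map, induced by the projections $G\to G/H^{(i)}$, is an isomorphism.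
   Context: $T$ is the infinite rooted binary tree whose vertices are the finite words over $\{0,1\}$, with root the empty word, each word $t$ being joined by an edge to $t0$ and $t1$. $W:=\operatorname{Aut}(T)$ is its automorphism group, a profinite group as the inverse limit of the finite groups $W_n=\operatorname{Aut}(T_n)$, where $T_n\subset T$ is the subtree of words of length $\le n$. For $u,v\in W$, $(u,v)\in W$ denotes the automorphism $0t\mapsto 0\,u(t)$, $1t\mapsto 1\,v(t)$ for all words $t$; $\sigma\in W$ is the automorphism of order $2$ with $0t\mapsto 1t$ and $1t\mapsto 0t$. Thus $W=(W\times W)\rtimes\langle\sigma\rangle$. The recursion relations for $a_1,\dots,a_r$ have a unique solution in $W$ (they determine the action on $T_n$ successively for all $n$). $\mathbb{Z}_2$ is the ring of $2$-adic integers. *)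

(* Defs.v *)
From HB Require Import structures.
From mathcomp Require Import all_boot all_order all_algebra.
From mathcomp Require Import all_classical topology function_spaces.
From mathcomp Require Import separation_axioms.

Set Implicit Arguments.
Unset Strict Implicit.
Unset Printing Implicit Defensive.

Local Open Scope quotient_scope.
Local Open Scope classical_set_scope.
Local Open Scope group_scope.

HB.mixin Record isTopologicalGroup G & Group G & Topological G := {
  mulg_continuous : continuous (fun p : G * G => p.1 * p.2) ;
  invg_continuous : continuous (fun x : G => x^-1)
}.

#[short(type="topGroupType")]
HB.structure Definition TopologicalGroup :=
  {G of Group G & Topological G & isTopologicalGroup G}.

Definition is_subgroup (G : groupType) (A : set G) : Prop :=
  [/\ A 1, forall x y, A x -> A y -> A (x * y) & forall x, A x -> A x^-1].

Definition generated_subgroup (G : groupType) (S : set G) : set G :=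
  smallest (@is_subgroup G) S.

Definition commutator_subgroup (G : groupType) : set G :=
  generated_subgroup [set z | exists x y : G, z = [~ x, y]].
Arguments commutator_subgroup : clear implicits.

Definition is_normal_subgroup (G : groupType) (N : set G) : Prop :=
  is_subgroup N /\ forall x g, N x -> N (x ^ g).

Record normalSubgroup (G : groupType) := NormalSubgroup {
  normal_set :> set G ;
  normal_setP : is_normal_subgroup normal_set
}.

Definition is_top_group_iso (G K : topGroupType) (f : G -> K) : Prop :=
  {morph f : x y / x * y} /\
  exists f' : K -> G,
    [/\ cancel f f', cancel f' f, continuous f & continuous f'].

Definition profinite (G : topGroupType) : Prop :=
  [/\ compact [set: G], hausdorff_space G & totally_disconnected [set: G]].

Definition profinite_abelian (G : topGroupType) : Prop :=
  profinite G /\ forall x y : G, x * y = y * x.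

Section GeneratedSubgroup.
Variable G : groupType.
Implicit Types (A S : set G).

Lemma generated_subgroupP S : is_subgroup (generated_subgroup S).
Proof.
split=> [A [[A1 _ _] _] // | x y Sx Sy A [sA SA] | x Sx A [sA SA]].
- by case: (sA) => _ AM _; apply: AM; [exact: Sx | exact: Sy].
- by case: (sA) => _ _ AV; apply: AV; exact: Sx.
Qed.

Lemma generated_subgroup_normal S :
  (forall x g, S x -> S (x ^ g)) -> is_normal_subgroup (generated_subgroup S).
Proof.
move=> SJ; split=> [|x g Sx]; first exact: generated_subgroupP.
have [S1 SM SV] := generated_subgroupP S.
suff: generated_subgroup S `<=` [set y | generated_subgroup S (y ^ g)] by apply.
apply: smallest_sub => [|y Sy] /=; last first.
  by apply: sub_gen_smallest; exact: SJ.
split=> /= [|u v Su Sv|u Su].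
- by rewrite conj1g.
- by rewrite conjMg; exact: SM.
- by rewrite conjVg; exact: SV.
Qed.

End GeneratedSubgroup.

Section ClosureSubgroup.
Variable G : topGroupType.
Implicit Types (A : set G).

Lemma mulg_nbhs (x y : G) (U : set G) : nbhs (x * y) U ->
  exists A B, [/\ nbhs x A, nbhs y B & forall u v, A u -> B v -> U (u * v)].
Proof.
move=> xyU; have /= [[A B] /= [xA yB] ABU] := @mulg_continuous G (x, y) U xyU.
by exists A, B; split=> // u v Au Bv; exact: (ABU (u, v)).
Qed.

Lemma mulgl_continuous (g : G) : continuous (fun x : G => g * x).
Proof.
move=> x U /mulg_nbhs[A [B [gA xB ABU]]] /=; apply: filterS xB => v Bv.
by apply: ABU => //; exact: nbhs_singleton.
Qed.

Lemma mulgr_continuous (g : G) : continuous (fun x : G => x * g).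
Proof.
move=> x U /mulg_nbhs[A [B [xA gB ABU]]] /=; apply: filterS xA => v Av.
by apply: ABU => //; exact: nbhs_singleton.
Qed.

Lemma closure_subgroup A : is_subgroup A -> is_subgroup (closure A).
Proof.
move=> [A1 AM AV]; split=> [|x y Ax Ay U|x Ax U].
- exact: subset_closure.
- move=> /mulg_nbhs[B [C [xB yC BCU]]].
  have [u [Au Bu]] := Ax _ xB; have [v [Av Cv]] := Ay _ yC.
  by exists (u * v); split; [exact: AM | exact: BCU].
- move=> /(@invg_continuous G x) xU.
  by have [u [Au Uu]] := Ax _ xU; exists u^-1; split=> //; exact: AV.
Qed.

Lemma closure_normal A : is_normal_subgroup A -> is_normal_subgroup (closure A).
Proof.
move=> [sA AJ]; split=> [|x g Ax U xU]; first exact: closure_subgroup.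
have cJ : continuous (fun x : G => x ^ g).
  move=> y; apply: (@continuous_comp _ _ _ (fun x : G => x * g) (fun x => g^-1 * x)).
    exact: mulgr_continuous.
  exact: mulgl_continuous.
have [u [Au Uu]] := Ax _ (cJ x U xU).
by exists (u ^ g); split => //; exact: AJ.
Qed.

Lemma closed_normal_closure_subproof (S : set G) :
  is_normal_subgroup (closure (generated_subgroup
    [set z | exists2 x, S x & exists g, z = x ^ g])).
Proof.
apply/closure_normal/generated_subgroup_normal => z g [x Sx [h ->]].
by exists x => //; exists (h * g); rewrite conjgM.
Qed.

Definition closed_normal_closure (S : set G) : normalSubgroup G :=
  NormalSubgroup (closed_normal_closure_subproof S).

End ClosureSubgroup.

Lemma normal_bigcap_subproof (G : groupType) (I : Type)
  (H : I -> normalSubgroup G) : is_normal_subgroup (\bigcap_i H i).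
Proof.
split=> [|x g Hx i _].
  split=> [i _|x y Hx Hy i _|x Hx i _]; have [[H1 HM HV] _] := normal_setP (H i).
  - exact: H1.
  - by apply: HM; [exact: Hx | exact: Hy].
  - by apply: HV; exact: Hx.
by have [_ HJ] := normal_setP (H i); apply: HJ; exact: Hx.
Qed.

Definition normal_bigcap (G : groupType) (I : Type)
    (H : I -> normalSubgroup G) : normalSubgroup G :=
  NormalSubgroup (normal_bigcap_subproof H).

Definition topgen (G : topGroupType) (S : set G) : Type :=
  set_type (closure (generated_subgroup S)).

Section TopGen.
Variables (G : topGroupType) (S : set G).
Local Notation K := (topgen S).

HB.instance Definition _ := SubChoice.on K.
HB.instance Definition _ := Topological.on K.

Lemma topgen_group_closed : group_closed (fun x : G => x \in closure (generated_subgroup S)).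
Proof.
have [A1 AM AV] := closure_subgroup (generated_subgroupP S).
split=> [|x y]; first exact/mem_set.
by move=> /set_mem Ax /set_mem Ay; apply/mem_set; apply: AM => //; exact: AV.
Qed.

HB.instance Definition _ :=
  SubChoice_isSubGroup.Build G _ K topgen_group_closed.

Lemma topgen_valM : {morph (val : K -> G) : x y / x * y}.
Proof. by []. Qed.

Lemma topgen_valV : {morph (val : K -> G) : x / x^-1}.
Proof. by []. Qed.

Lemma topgen_val_continuous : continuous (val : K -> G).
Proof. exact: initial_continuous. Qed.

Lemma topgen_mul_continuous : continuous (fun p : K * K => p.1 * p.2).
Proof.
apply/(@continuous_comp_initial _ _ _ (val : K -> G)) => -[x y] U /=.
move=> /mulg_nbhs[A [B [xA yB ABU]]].
exists (val @^-1` A, val @^-1` B) => /=.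
  by split; [exact: (@topgen_val_continuous x) | exact: (@topgen_val_continuous y)].
by move=> [u v] /= [Au Bv]; exact: ABU.
Qed.

Lemma topgen_inv_continuous : continuous (fun x : K => x^-1).
Proof.
apply/(@continuous_comp_initial _ _ _ (val : K -> G)) => x U /=.
move=> /(@invg_continuous G (val x)) xU.
exact: (@topgen_val_continuous x _ xU).
Qed.

HB.instance Definition _ := isTopologicalGroup.Build K
  topgen_mul_continuous topgen_inv_continuous.

End TopGen.

Section CosetEquiv.
Variables (G : groupType) (N : normalSubgroup G).

Definition coset_rel : rel G := fun x y => `[< normal_set N (x^-1 * y) >].

Lemma coset_rel_equiv : equiv_class_of coset_rel.
Proof.
have [[N1 NM NV] NJ] := normal_setP N; split=> [x|x y|y x z].
- by apply/asboolP; rewrite mulVg.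
- by apply/asboolP/asboolP => /NV; rewrite invgM invgK.
- move=> /asboolP xy /asboolP yz; apply/asboolP.
  by have := NM _ _ xy yz; rewrite mulgA mulgK.
Qed.

Canonical coset_equiv := EquivRelPack coset_rel_equiv.

End CosetEquiv.

Definition quotg (G : topGroupType) (N : normalSubgroup G) : Type :=
  quotient_topology {eq_quot (coset_equiv N)}.

Section QuotGroup.
Variables (G : topGroupType) (N : normalSubgroup G).
Local Notation Q := (quotg N).
Local Notation p := (\pi_Q : G -> Q).

HB.instance Definition _ := Quotient.on Q.
HB.instance Definition _ := Topological.on Q.

Lemma quotg_eqP (x y : G) : \pi_Q x = \pi_Q y <-> normal_set N (x^-1 * y).
Proof.
by split=> [/(@eqmodP _ (coset_equiv N)) /asboolP|Nxy] //;
  apply/(@eqmodP _ (coset_equiv N))/asboolP.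
Qed.

Definition quotg_one : Q := \pi_Q 1.
Definition quotg_mul (u v : Q) : Q := \pi_Q (repr u * repr v).
Definition quotg_inv (u : Q) : Q := \pi_Q (repr u)^-1.

Lemma quotg_repr (x : G) : normal_set N (x^-1 * repr (\pi_Q x)).
Proof. by apply/quotg_eqP; rewrite reprK. Qed.

Lemma quotg_mulE (x y : G) : quotg_mul (\pi_Q x) (\pi_Q y) = \pi_Q (x * y).
Proof.
have [[N1 NM NV] NJ] := normal_setP N.
apply/esym/quotg_eqP.
have := NM _ _ (NJ _ y (quotg_repr x)) (quotg_repr y).
by rewrite /conjg invgM !mulgA mulgK.
Qed.

Lemma quotg_invE (x : G) : quotg_inv (\pi_Q x) = \pi_Q x^-1.
Proof.
have [[N1 NM NV] NJ] := normal_setP N.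
apply/quotg_eqP; rewrite invgK.
by have := NJ _ x^-1 (quotg_repr x); rewrite /conjg invgK !mulgA mulgV mul1g.
Qed.

Lemma quotg_mulA : associative quotg_mul.
Proof.
elim/quotW=> x; elim/quotW=> y; elim/quotW=> z.
by rewrite (quotg_mulE y z) (quotg_mulE x y) !quotg_mulE mulgA.
Qed.

Lemma quotg_mul1 : left_id quotg_one quotg_mul.
Proof. by elim/quotW=> x; rewrite quotg_mulE mul1g. Qed.

Lemma quotg_1mul : right_id quotg_one quotg_mul.
Proof. by elim/quotW=> x; rewrite quotg_mulE mulg1. Qed.

Lemma quotg_mulV : left_inverse quotg_one quotg_inv quotg_mul.
Proof. by elim/quotW=> x; rewrite quotg_invE quotg_mulE mulVg. Qed.

Lemma quotg_Vmul : right_inverse quotg_one quotg_inv quotg_mul.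
Proof. by elim/quotW=> x; rewrite quotg_invE quotg_mulE mulgV. Qed.

HB.instance Definition _ := isGroup.Build Q
  quotg_mulA quotg_mul1 quotg_1mul quotg_mulV quotg_Vmul.

Lemma quotg_piM (x y : G) : \pi_Q (x * y) = \pi_Q x * \pi_Q y.
Proof. exact: esym (quotg_mulE x y). Qed.

Lemma quotg_piV (x : G) : \pi_Q x^-1 = (\pi_Q x)^-1.
Proof. exact: esym (quotg_invE x). Qed.

Lemma quotg_pi_continuous : continuous p.
Proof. exact: pi_continuous. Qed.

Lemma quotg_pi_open (x : G) (U : set G) : nbhs x U -> nbhs (\pi_Q x) (p @` U).
Proof.
rewrite nbhsE => -[V [oV Vx] VU].
suff oQ : open (p @` V).
  apply: (@filterS _ _ _ (p @` V)); first exact: image_subset.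
  by apply: open_nbhs_nbhs; split=> //; exists x.
rewrite /open /= /quotient_open.
have -> : p @^-1` (p @` V) = \bigcup_(n in N) [set y | V (y * n)].
  apply/seteqP; split=> y /=.
    by case=> v Vv /esym/quotg_eqP Ny; exists (y^-1 * v); rewrite //= mulVKg.
  by move=> [n Nn /= Vyn]; exists (y * n) => //; apply/esym/quotg_eqP; rewrite mulKg.
apply: bigcup_open => n _.
by apply: (open_comp _ oV) => y _; exact: mulgr_continuous.
Qed.

Lemma quotg_mul_continuous : continuous (fun q : Q * Q => q.1 * q.2).
Proof.
move=> [u v] U /=; rewrite -[u]reprK -[v]reprK -quotg_piM.
move=> /(@quotg_pi_continuous (repr u * repr v)) /mulg_nbhs[A [B [uA vB ABU]]].
exists (p @` A, p @` B) => /=; first by split; exact: quotg_pi_open.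
move=> [_ _] /= [[x Ax <-] [y By <-]].
by rewrite -quotg_piM; exact: ABU.
Qed.

Lemma quotg_inv_continuous : continuous (fun u : Q => u^-1).
Proof.
move=> u U /=; rewrite -[u]reprK -quotg_piV.
move=> /(@quotg_pi_continuous (repr u)^-1) /(@invg_continuous G (repr u)) uU.
apply: filterS (quotg_pi_open uU) => _ [x Ux <-] /=.
by rewrite -quotg_piV.
Qed.

HB.instance Definition _ := isTopologicalGroup.Build Q
  quotg_mul_continuous quotg_inv_continuous.

End QuotGroup.

(* G/N is the largest factor group of G that is profinite and abelian: every
   other one, G/N', is a factor group of G/N. *)
Definition is_max_profinite_abelian_factor (G : topGroupType)
    (N : normalSubgroup G) : Prop :=
  profinite_abelian (quotg N) /\
  forall N' : normalSubgroup G, profinite_abelian (quotg N') -> N `<=` N'.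

Section ProdGroup.
Variables (I : Type) (T : I -> topGroupType).
Local Notation P := (prod_topology (fun i => T i)).

Definition prodg_one : P := fun=> 1.
Definition prodg_mul (x y : P) : P := fun i => x i * y i.
Definition prodg_inv (x : P) : P := fun i => (x i)^-1.

Lemma prodg_mulA : associative prodg_mul.
Proof. by move=> x y z; apply: functional_extensionality_dep => i; exact: mulgA. Qed.
Lemma prodg_mul1 : left_id prodg_one prodg_mul.
Proof. by move=> x; apply: functional_extensionality_dep => i; exact: mul1g. Qed.
Lemma prodg_1mul : right_id prodg_one prodg_mul.
Proof. by move=> x; apply: functional_extensionality_dep => i; exact: mulg1. Qed.
Lemma prodg_mulV : left_inverse prodg_one prodg_inv prodg_mul.
Proof. by move=> x; apply: functional_extensionality_dep => i; exact: mulVg. Qed.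
Lemma prodg_Vmul : right_inverse prodg_one prodg_inv prodg_mul.
Proof. by move=> x; apply: functional_extensionality_dep => i; exact: mulgV. Qed.

HB.instance Definition _ := isGroup.Build P
  prodg_mulA prodg_mul1 prodg_1mul prodg_mulV prodg_Vmul.

Lemma prodg_proj_continuous (i : I) : continuous (fun x : P => x i).
Proof.
move=> x U xU.
have /cvg_sup/(_ i) : (nbhs x : set_system P) --> x by [].
by apply; exact: (@initial_continuous _ _ (fun f : P => f i)).
Qed.

Lemma prodg_continuous (X : topologicalType) (f : X -> P) :
  (forall i, continuous (fun x => f x i)) -> continuous f.
Proof.
move=> fc x; apply/cvg_sup => i.
by apply: (@continuous_comp_initial _ _ _ (fun f : P => f i) f); exact: fc.
Qed.

Lemma prodg_mul_continuous : continuous (fun q : P * P => q.1 * q.2).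
Proof.
apply: prodg_continuous => i -[x y] U /=.
move=> /mulg_nbhs[A [B [xA yB ABU]]].
exists ((fun x : P => x i) @^-1` A, (fun x : P => x i) @^-1` B) => /=.
  by split; exact: (@prodg_proj_continuous i).
by move=> [u v] /= [Au Bv]; exact: ABU.
Qed.

Lemma prodg_inv_continuous : continuous (fun x : P => x^-1).
Proof.
apply: prodg_continuous => i x U /= /(@invg_continuous (T i) (x i)) xU.
exact: (@prodg_proj_continuous i x _ xU).
Qed.

HB.instance Definition _ := isTopologicalGroup.Build P
  prodg_mul_continuous prodg_inv_continuous.

End ProdGroup.

(* If [e n x y] says that x and y have the same image in the n-th (discrete)
   space of an inverse system, then [limit_open e] consists of the open sets
   of the limit topology: the fibres of the projections form a basis. *)
Definition limit_open (T : Type) (e : nat -> T -> T -> Prop) : set_system T :=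
  [set U | forall x, U x -> exists n, e n x `<=` U].

Section LimitOpen.
Variables (T : Type) (e : nat -> T -> T -> Prop).
Hypothesis e_le : forall m n x y, (m <= n)%N -> e n x y -> e m x y.

Lemma limit_openT : limit_open e setT.
Proof. by move=> x _; exists 0%N. Qed.

Lemma limit_openI : setI_closed (limit_open e).
Proof.
move=> A B oA oB x [/oA[m mA] /oB[n nB]]; exists (maxn m n) => y exy; split.
  by apply: mA; apply: e_le exy; rewrite leq_maxl.
by apply: nB; apply: e_le exy; rewrite leq_maxr.
Qed.

Lemma limit_open_bigU (I : Type) (f : I -> set T) :
  (forall i, limit_open e (f i)) -> limit_open e (\bigcup_i f i).
Proof.
by move=> fo x [i _ /fo[n nf]]; exists n => y /nf fy; exists i.
Qed.

End LimitOpen.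

(* Words over {0, 1}: false stands for 0, true for 1, the first letter is the
   head of the list; a word t is joined to the words [rcons t b]. *)
Notation word := (seq bool).

Definition tree_edge (s t : word) : Prop :=
  exists b, t = rcons s b \/ s = rcons t b.

Record tree_aut := TreeAut {
  taut :> word -> word ;
  taut_inv : word -> word ;
  tautK : cancel taut taut_inv ;
  taut_invK : cancel taut_inv taut ;
  taut_root : taut [::] = [::] ;
  taut_edge : forall s t, tree_edge (taut s) (taut t) <-> tree_edge s t
}.

Notation W := tree_aut.

Lemma taut_inj (u : W) : injective u. Proof. exact: can_inj (tautK u). Qed.

Lemma tautP (u v : W) : u =1 v -> u = v.
Proof.
case: u v => [u u' uK u'K u0 ue] [v v' vK v'K v0 ve] /= /funext uv.
have u'v' : u' = v' by apply/funext => t; apply: (can_inj vK); rewrite v'K -uv u'K.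
by rewrite uv u'v' in uK u'K u0 ue *; f_equal; exact: Prop_irrelevance.
Qed.

Lemma taut_edge_rcons (u : W) s b : tree_edge (u s) (u (rcons s b)).
Proof. by apply/taut_edge; exists b; left. Qed.

Lemma taut_size (u : W) t : size (u t) = size t.
Proof.
have neqSS n : n = n.+2 -> False.
  by move/eqP; rewrite eqn_leq [X in _ && X]ltnNge leqnSn andbF.
elim/last_ind: t {-2}t (leqnn (size t)) => [|t0 b0 IH].
  by case=> // _; rewrite taut_root.
move=> t; case/lastP: t => [|s b]; first by rewrite taut_root.
rewrite !size_rcons ltnS => s_le.
case: (taut_edge_rcons u s b) => c [->|us]; first by rewrite size_rcons IH.
case/lastP: s s_le us => [|s d] s_le us.
  by move: us; rewrite taut_root => /(congr1 size); rewrite size_rcons.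
have s_le' : (size s <= size t0)%N by rewrite size_rcons in s_le; exact: ltnW.
case: (taut_edge_rcons u s d) => c' [usd|usd].
  move: us; rewrite usd => /rcons_inj[/taut_inj /(congr1 size)].
  by rewrite !size_rcons => /neqSS.
by move: (IH _ s_le'); rewrite usd size_rcons IH // size_rcons => /esym/neqSS.
Qed.

Local Obligation Tactic := idtac.

Program Definition taut_id : W := @TreeAut id id _ _ _ _.
Next Obligation. by []. Qed.
Next Obligation. by []. Qed.
Next Obligation. by []. Qed.
Next Obligation. by []. Qed.

(* Automorphisms act from the left: (u * v) t = u (v t). *)
Program Definition taut_comp (u v : W) : W :=
  @TreeAut (u \o v) (taut_inv v \o taut_inv u) _ _ _ _.
Next Obligation. by move=> u v t /=; rewrite !tautK. Qed.
Next Obligation. by move=> u v t /=; rewrite !taut_invK. Qed.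
Next Obligation. by move=> u v; rewrite /= !taut_root. Qed.
Next Obligation. by move=> u v s t; rewrite /= !taut_edge. Qed.

Program Definition taut_sym (u : W) : W :=
  @TreeAut (taut_inv u) u (taut_invK u) (tautK u) _ _.
Next Obligation. by move=> u; rewrite -{1}(taut_root u) tautK. Qed.
Next Obligation. by move=> u s t; rewrite -(taut_edge u) !taut_invK. Qed.

HB.instance Definition _ := gen_eqMixin tree_aut.
HB.instance Definition _ := gen_choiceMixin tree_aut.

Lemma taut_compA : associative taut_comp.
Proof. by move=> u v w; exact: tautP. Qed.
Lemma taut_comp1 : left_id taut_id taut_comp.
Proof. by move=> u; exact: tautP. Qed.
Lemma taut_1comp : right_id taut_id taut_comp.
Proof. by move=> u; exact: tautP. Qed.
Lemma taut_compV : left_inverse taut_id taut_sym taut_comp.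
Proof. by move=> u; apply: tautP => t /=; rewrite tautK. Qed.
Lemma taut_Vcomp : right_inverse taut_id taut_sym taut_comp.
Proof. by move=> u; apply: tautP => t /=; rewrite taut_invK. Qed.

HB.instance Definition _ := isGroup.Build tree_aut
  taut_compA taut_comp1 taut_1comp taut_compV taut_Vcomp.

(* u and v have the same restriction to the subtree of words of length <= n. *)
Definition eq_level (n : nat) (u v : W) : Prop :=
  forall t : word, (size t <= n)%N -> u t = v t.

Lemma eq_level_le m n u v : (m <= n)%N -> eq_level n u v -> eq_level m u v.
Proof. by move=> mn uv t tm; apply: uv; exact: leq_trans mn. Qed.

HB.instance Definition _ := isOpenTopological.Build tree_aut
  (limit_openT eq_level) (limit_openI eq_level_le)
  (@limit_open_bigU _ eq_level).

Lemma taut_nbhsP (u : W) (U : set W) :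
  nbhs u U <-> exists n, eq_level n u `<=` U.
Proof.
rewrite nbhsE; split=> [[V [oV Vu] VU]|[n nU]].
  by have [n nV] := oV u Vu; exists n; exact: subset_trans VU.
exists (eq_level n u) => //; split; last by [].
move=> v uv; exists n => w vw t tn.
by rewrite uv// vw.
Qed.

Lemma taut_mul_continuous : continuous (fun p : W * W => p.1 * p.2).
Proof.
move=> [u v] U /= /taut_nbhsP[n nU]; exists (eq_level n u, eq_level n v) => /=.
  by split; apply/taut_nbhsP; exists n.
move=> [u' v'] /= [uu' vv']; apply: nU => t tn /=.
by rewrite /= -vv'// uu'// taut_size.
Qed.

Lemma taut_inv_continuous : continuous (fun u : W => u^-1).
Proof.
move=> u U /= /taut_nbhsP[n nU]; apply/taut_nbhsP; exists n => v uv /=.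
apply: nU => t tn /=; apply: (@taut_inj v); rewrite -[in LHS]uv.
  by rewrite taut_invK [RHS]taut_invK.
by rewrite -(taut_size u) taut_invK.
Qed.

HB.instance Definition _ := isTopologicalGroup.Build tree_aut
  taut_mul_continuous taut_inv_continuous.

(* The automorphism (u, v): 0t |-> 0 u(t), 1t |-> 1 v(t). *)
Definition pair_fun (u v : word -> word) (t : word) : word :=
  match t with
  | [::] => [::]
  | false :: t' => false :: u t'
  | true :: t' => true :: v t'
  end.

Definition flip_fun (t : word) : word :=
  if t is b :: t' then ~~ b :: t' else [::].

Lemma tree_edge_cons b c s t :
  tree_edge (b :: s) (c :: t) <-> b = c /\ tree_edge s t.
Proof.
split=> [[d [] /= [-> ->]]|[<- [d [->|->]]]].
- by split=> //; exists d; left.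
- by split=> //; exists d; right.
- by exists d; left.
- by exists d; right.
Qed.

Lemma tree_edge_nil_cons b t : tree_edge [::] (b :: t) <-> t = [::].
Proof.
split=> [[d [[_ ->]|/(congr1 size)]]|->] //; last by exists b; left.
Qed.

Lemma tree_edge_sym s t : tree_edge s t <-> tree_edge t s.
Proof. by split=> -[b [->|->]]; exists b; [right|left|right|left]. Qed.

Lemma tree_edge_nil : ~ tree_edge [::] [::].
Proof. by case=> b [|] /(congr1 size). Qed.

Lemma taut_eq_nil (u : W) t : u t = [::] <-> t = [::].
Proof.
by split=> [ut|->]; [apply: (@taut_inj u); rewrite taut_root | exact: taut_root].
Qed.

Program Definition taut_pair (u v : W) : W :=
  @TreeAut (pair_fun u v) (pair_fun (taut_inv u) (taut_inv v)) _ _ _ _.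
Next Obligation. by move=> u v [|[] t] //=; rewrite tautK. Qed.
Next Obligation. by move=> u v [|[] t] //=; rewrite taut_invK. Qed.
Next Obligation. by []. Qed.
Next Obligation.
move=> u v s t.
have nilE b t' : tree_edge [::] (pair_fun u v (b :: t')) <-> tree_edge [::] (b :: t').
  by case: b => /=; rewrite !tree_edge_nil_cons taut_eq_nil.
case: s t => [|b s] [|c t].
- by [].
- exact: nilE.
- by rewrite tree_edge_sym (tree_edge_sym (b :: s)); exact: nilE.
- by case: b c => -[] /=; rewrite !tree_edge_cons ?taut_edge; intuition.
Qed.

Program Definition taut_flip : W := @TreeAut flip_fun flip_fun _ _ _ _.
Next Obligation. by case=> [|[] t]. Qed.
Next Obligation. by case=> [|[] t]. Qed.
Next Obligation. by []. Qed.
Next Obligation.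
case=> [|b s] [|c t] //=.
- by rewrite !tree_edge_nil_cons.
- by rewrite tree_edge_sym (tree_edge_sym (b :: s)) !tree_edge_nil_cons.
- by rewrite !tree_edge_cons; case: b c => -[]; intuition.
Qed.

(* The recursion a_1 = (a_r, 1) sigma and a_i = (a_{i-1}, 1) for 2 <= i <= r;
   the index i : 'I_r stands for i + 1. *)
Definition tree_recursion (r : nat) (a : 'I_r -> W) : Prop :=
  (forall i j : 'I_r, i = 0%N :> nat -> j = r.-1 :> nat ->
     a i = taut_pair (a j) 1 * taut_flip) /\
  (forall i j : 'I_r, i = j.+1 :> nat -> a i = taut_pair (a j) 1).

Fixpoint gen_fun (r i : nat) (t : word) : word :=
  match t with
  | [::] => [::]
  | b :: t' =>
      if i is j.+1 then if b then true :: t' else false :: gen_fun r j t'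
      else if b then false :: gen_fun r r.-1 t' else true :: t'
  end.

Fixpoint gen_inv (r i : nat) (t : word) : word :=
  match t with
  | [::] => [::]
  | b :: t' =>
      if i is j.+1 then if b then true :: t' else false :: gen_inv r j t'
      else if b then false :: t' else true :: gen_inv r r.-1 t'
  end.

Lemma gen_edge r i s t :
  tree_edge (gen_fun r i s) (gen_fun r i t) <-> tree_edge s t.
Proof.
have nilE k t' : gen_fun r k t' = [::] <-> t' = [::].
  by case: t' k => [|[] t'] [|k].
have nil_edge k b t' :
    tree_edge [::] (gen_fun r k (b :: t')) <-> tree_edge [::] (b :: t').
  by case: b k => [] [|k] /=; rewrite !tree_edge_nil_cons ?nilE.
elim: s t i => [|b s IH] [|c t] i //.
- by rewrite tree_edge_sym (tree_edge_sym (b :: s)).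
- by case: b c i => [] [] [|i] /=; rewrite !tree_edge_cons ?IH; intuition.
Qed.

Program Definition gen_aut (r i : nat) : W :=
  @TreeAut (gen_fun r i) (gen_inv r i) _ _ _ (gen_edge r i).
Next Obligation. by move=> r i t; elim: t i => // -[] t IH [|i] /=; rewrite ?IH. Qed.
Next Obligation. by move=> r i t; elim: t i => // -[] t IH [|i] /=; rewrite ?IH. Qed.
Next Obligation. by []. Qed.

Lemma tree_recursion_unique (r : nat) :
  exists! a : 'I_r -> W, tree_recursion a.
Proof.
exists (fun i => gen_aut r i); split.
  by split=> i j /= -> => [->|]; apply: tautP => -[|[] t].
move=> a [a1 a2]; apply/funext => i; apply: tautP => t /=.
elim: t i => [|b t IH] [[|i] lt_ir]; rewrite ?taut_root //=.
  have lt_r : (r.-1 < r)%N by case: (r) lt_ir.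
  rewrite (a1 _ (Ordinal lt_r)) //=; case: b => //=.
  by rewrite -(IH (Ordinal lt_r)).
rewrite (a2 _ (Ordinal (ltnW lt_ir))) //=; case: b => //=.
by rewrite -(IH (Ordinal (ltnW lt_ir))).
Qed.

(* The inverse limit of the rings Z/2^n; since ['Z_1] is not the zero ring, the
   system is indexed by the exponents n.+1 (which are cofinal). *)
Record Z2 := MkZ2 {
  z2 : forall n, 'Z_(expn 2 n.+1) ;
  z2P : forall n, (z2 n.+1 = z2 n %[mod 2 ^ n.+1])%N
}.

Lemma z2_inj (x y : Z2) : (forall n, z2 x n = z2 y n) -> x = y.
Proof.
case: x y => [x xP] [y yP] /= xy.
have {}xy : x = y by apply: functional_extensionality_dep.
by subst y; f_equal; exact: Prop_irrelevance.
Qed.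

HB.instance Definition _ := gen_eqMixin Z2.
HB.instance Definition _ := gen_choiceMixin Z2.

Lemma ltn1_exp2 n : (1 < 2 ^ n.+1)%N.
Proof. by rewrite -[1%N](expn0 2) ltn_exp2l. Qed.

Lemma val_Z2D n (x y : 'Z_(expn 2 n.+1)) :
  ((x + y)%R : nat) = ((x + y) %% 2 ^ n.+1)%N.
Proof. by congr modn; exact: Zp_cast (ltn1_exp2 n). Qed.

Lemma val_Z2N n (x : 'Z_(expn 2 n.+1)) :
  ((- x)%R : nat) = ((2 ^ n.+1 - x) %% 2 ^ n.+1)%N.
Proof. by congr ((_ - _) %% _)%N; exact: Zp_cast (ltn1_exp2 n). Qed.

Lemma val_Z2M n (x y : 'Z_(expn 2 n.+1)) :
  ((x * y)%R : nat) = ((x * y) %% 2 ^ n.+1)%N.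
Proof. by congr modn; exact: Zp_cast (ltn1_exp2 n). Qed.

Lemma ltn_Z2 n (x : 'Z_(expn 2 n.+1)) : (x < 2 ^ n.+1)%N.
Proof. by rewrite -[ltnRHS](Zp_cast (ltn1_exp2 n)). Qed.

Lemma modn_exp2S m n : (m %% 2 ^ n.+1 = m %[mod 2 ^ n])%N.
Proof. by rewrite modn_dvdm // dvdn_exp2l. Qed.

Lemma modn_opp m p a b : (p %| m)%N -> (a <= m)%N -> (b <= p)%N ->
  (a = b %[mod p])%N -> (m - a = p - b %[mod p])%N.
Proof.
move=> pm am bp ab; apply/eqP; rewrite -(eqn_modDr a) subnK //.
by rewrite -(modnDmr _ a) ab modnDmr subnK // modnn.
Qed.

Program Definition z2_zero : Z2 := @MkZ2 (fun n => 0%R) _.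
Next Obligation. by []. Qed.
Program Definition z2_one : Z2 := @MkZ2 (fun n => 1%R) _.
Next Obligation. by []. Qed.
Program Definition z2_add (x y : Z2) : Z2 :=
  @MkZ2 (fun n => z2 x n + z2 y n)%R _.
Next Obligation.
move=> x y n; rewrite !val_Z2D modn_exp2S modn_mod.
by rewrite -modnDm (z2P x) (z2P y) modnDm.
Qed.
Program Definition z2_opp (x : Z2) : Z2 := @MkZ2 (fun n => - z2 x n)%R _.
Next Obligation.
move=> x n; rewrite !val_Z2N modn_exp2S modn_mod.
apply: modn_opp; last exact: (z2P x n).
- by rewrite dvdn_exp2l.
- by apply: ltnW; exact: ltn_Z2.
- by apply: ltnW; exact: ltn_Z2.
Qed.
Program Definition z2_mul (x y : Z2) : Z2 :=
  @MkZ2 (fun n => z2 x n * z2 y n)%R _.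
Next Obligation.
move=> x y n; rewrite !val_Z2M modn_exp2S modn_mod.
by rewrite -modnMm (z2P x) (z2P y) modnMm.
Qed.

Lemma z2_addA : associative z2_add.
Proof. by move=> x y z; apply: z2_inj => n /=; exact: GRing.addrA. Qed.
Lemma z2_addC : commutative z2_add.
Proof. by move=> x y; apply: z2_inj => n /=; exact: GRing.addrC. Qed.
Lemma z2_add0 : left_id z2_zero z2_add.
Proof. by move=> x; apply: z2_inj => n /=; exact: GRing.add0r. Qed.
Lemma z2_addN : left_inverse z2_zero z2_opp z2_add.
Proof. by move=> x; apply: z2_inj => n /=; exact: GRing.addNr. Qed.

HB.instance Definition _ := GRing.isZmodule.Build Z2
  z2_addA z2_addC z2_add0 z2_addN.

Lemma z2_mulA : associative z2_mul.
Proof. by move=> x y z; apply: z2_inj => n /=; exact: GRing.mulrA. Qed.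
Lemma z2_mulC : commutative z2_mul.
Proof. by move=> x y; apply: z2_inj => n /=; exact: GRing.mulrC. Qed.
Lemma z2_mul1 : left_id z2_one z2_mul.
Proof. by move=> x; apply: z2_inj => n /=; exact: GRing.mul1r. Qed.
Lemma z2_mulDl : left_distributive z2_mul z2_add.
Proof. by move=> x y z; apply: z2_inj => n /=; exact: GRing.mulrDl. Qed.
Lemma z2_one_neq0 : z2_one != z2_zero.
Proof. by apply/eqP => /(congr1 (fun x : Z2 => val (z2 x 0))). Qed.

HB.instance Definition _ := GRing.Zmodule_isComNzRing.Build Z2
  z2_mulA z2_mulC z2_mul1 z2_mulDl z2_one_neq0.

Definition eq_mod (n : nat) (x y : Z2) : Prop := z2 x n = z2 y n.

Lemma eq_mod_le m n x y : (m <= n)%N -> eq_mod n x y -> eq_mod m x y.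
Proof.
elim: n => [|n IH]; first by rewrite leqn0 => /eqP ->.
rewrite leq_eqVlt => /orP[/eqP -> //|/IH{}IH] xy; apply: IH.
apply: val_inj => /=; move: (z2P x n) (z2P y n); rewrite xy => ->.
by rewrite !modn_small ?ltn_Z2.
Qed.

HB.instance Definition _ := isOpenTopological.Build Z2
  (limit_openT eq_mod) (limit_openI eq_mod_le) (@limit_open_bigU _ eq_mod).

Lemma z2_nbhsP (x : Z2) (U : set Z2) :
  nbhs x U <-> exists n, eq_mod n x `<=` U.
Proof.
rewrite nbhsE; split=> [[V [oV Vx] VU]|[n nU]].
  by have [n nV] := oV x Vx; exists n; exact: subset_trans VU.
exists (eq_mod n x) => //; split; last by [].
by move=> v xv; exists n => w vw; rewrite /eq_mod xv.
Qed.

(* The additive group of Z2, written multiplicatively. *)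
Definition Z2add : Type := Algebra.to_multiplicative Z2.

HB.instance Definition _ := Group.copy Z2add (Algebra.to_multiplicative Z2).
HB.instance Definition _ := Topological.copy Z2add Z2.

Lemma z2_add_continuous : continuous (fun p : Z2add * Z2add => p.1 * p.2).
Proof.
move=> [x y] U /= /z2_nbhsP[n nU]; exists (eq_mod n x, eq_mod n y) => /=.
  by split; apply/z2_nbhsP; exists n.
by move=> [x' y'] /= [xx' yy']; apply: nU; rewrite /eq_mod /= xx' yy'.
Qed.

Lemma z2_opp_continuous : continuous (fun x : Z2add => x^-1).
Proof.
move=> x U /= /z2_nbhsP[n nU]; apply/z2_nbhsP; exists n => y xy /=.
by apply: nU; rewrite /eq_mod /= xy.
Qed.

HB.instance Definition _ := isTopologicalGroup.Build Z2add
  z2_add_continuous z2_opp_continuous.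

(* Main.v *)
(* Take a positive word s in the generators, so that its value is
   (u, v) sigma^e for two words u, v. Then a_i (i >= 2) occurs in s as often as
   a_(i-1) occurs in u and v together, while a_1 occurs 2 k + e times in s, where
   k is the number of occurrences of a_r in v. By induction on the level, the
   action of s on a deep enough level determines every number of occurrences
   modulo 2^n. Since positive words are dense in G, counting a_i extends to a
   continuous character chi_i : G -> Z_2, and these are jointly onto Z_2^r by
   compactness. If chi_i g = 0, then g is approximated by words s in which a_i
   occurs a multiple of 2^n times; as a_i^(2^n) acts trivially on level n, the
   letters a_i can be dropped and g lies in H^(i). If all chi_i vanish at g,
   reordering the letters of s shows that g lies in the closure of [G, G]. *)

Require Import Defs.
From HB Require Import structures.
From mathcomp Require Import all_boot all_order all_algebra.
From mathcomp Require Import all_classical topology function_spaces.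
From mathcomp Require Import separation_axioms.
From mathcomp Require Import zify.

Set Implicit Arguments.
Unset Strict Implicit.
Unset Printing Implicit Defensive.

Local Open Scope quotient_scope.
Local Open Scope classical_set_scope.
Local Open Scope group_scope.

(** * Positive words: their values and letter counts *)

Section WordProduct.
Variables (I : eqType) (M : groupType) (g : I -> M).

Definition wprod (s : seq I) : M := foldr (fun i x => g i * x) 1 s.

Lemma wprod_cat s t : wprod (s ++ t) = wprod s * wprod t.
Proof. by elim: s => [|i s IH] /=; rewrite ?mul1g// IH mulgA. Qed.

Lemma wprod_nseq k i : wprod (nseq k i) = g i ^+ k.
Proof. by elim: k => [|k IH] //=; rewrite IH expgS. Qed.

End WordProduct.

Definition occ (I : eqType) (i : I) (s : seq I) : nat := count_mem i s.
Arguments occ : simpl never.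

Lemma occ_cons (I : eqType) (i k : I) s : occ i (k :: s) = ((k == i) + occ i s)%N.
Proof. by []. Qed.

Section SpreadWord.
Variable I : finType.

(** A word sorted into one block per letter: the normal form of a word up to reordering, and a
    realization of any prescribed counts. *)
Definition spread (c : I -> nat) : seq I := flatten [seq nseq (c i) i | i <- index_enum I].

Lemma occ_spread c i : occ i (spread c) = c i.
Proof.
rewrite /occ /spread count_flatten -!map_comp sumnE big_map /=.
rewrite (bigD1 i)//= count_nseq /= eqxx mul1n big1 ?addn0// => j ji.
by rewrite count_nseq /= (negPf ji).
Qed.

Lemma perm_spread s : perm_eq (spread (fun i => occ i s)) s.
Proof. by apply/allP => i _ /=; rewrite -[X in X == _]/(occ i _) occ_spread. Qed.

End SpreadWord.

(** * Elements of [W] up to a level of the tree *)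

Section Levels.
Implicit Types u v w : W.

Lemma eq_level_sym n u v : eq_level n u v -> eq_level n v u.
Proof. by move=> uv t tn; rewrite uv. Qed.

Lemma eq_level_trans n u v w : eq_level n u v -> eq_level n v w -> eq_level n u w.
Proof. by move=> uv vw t tn; rewrite uv// vw. Qed.

Lemma eq_levelM n u u' v v' :
  eq_level n u u' -> eq_level n v v' -> eq_level n (u * v) (u' * v').
Proof. by move=> uu vv t tn; rewrite /= vv// uu// taut_size. Qed.

Lemma eq_levelV n u v : eq_level n u v -> eq_level n u^-1 v^-1.
Proof.
move=> uv t tn /=; apply: (@taut_inj v); rewrite -[in LHS]uv.
  by rewrite taut_invK [RHS]taut_invK.
by rewrite -(taut_size u) taut_invK.
Qed.

Lemma eq_levelX n k u v : eq_level n u v -> eq_level n (u ^+ k) (v ^+ k).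
Proof.
move=> uv; elim: k => [|k IH]; first by rewrite !expg0.
by rewrite !expgS; exact: eq_levelM.
Qed.

Lemma eq_level0 u v : eq_level 0 u v.
Proof. by move=> [|b t]//; rewrite !taut_root. Qed.

Lemma taut_pairM u v u' v' :
  taut_pair u v * taut_pair u' v' = taut_pair (u * u') (v * v').
Proof. by apply: tautP => -[|[] t]. Qed.

Lemma taut_pair11 : taut_pair 1 1 = 1.
Proof. by apply: tautP => -[|[] t]. Qed.

Lemma taut_flip_pair u v : taut_flip * taut_pair u v = taut_pair v u * taut_flip.
Proof. by apply: tautP => -[|[] t]. Qed.

Lemma taut_flip2 : taut_flip * taut_flip = 1.
Proof. by apply: tautP => -[|[] t]. Qed.

Lemma taut_pairX k u v : taut_pair u v ^+ k = taut_pair (u ^+ k) (v ^+ k).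
Proof.
elim: k => [|k IH]; first by rewrite !expg0 taut_pair11.
by rewrite !expgS IH taut_pairM.
Qed.

Lemma eq_level_pair n u v u' v' :
  eq_level n u u' -> eq_level n v v' ->
  eq_level n.+1 (taut_pair u v) (taut_pair u' v').
Proof. by move=> uu vv [|[] t] //= tn; rewrite ?uu ?vv. Qed.

Definition flip_if (e : bool) : W := if e then taut_flip else 1.

(** The image of the word [[:: false]] shows [e]. Words beginning with [e] are then sent below the
    vertex 0 and exhibit [u]; those beginning with [~~ e] exhibit [v]. *)
Lemma eq_level_flip n u v u' v' e e' :
  eq_level n.+1 (taut_pair u v * flip_if e) (taut_pair u' v' * flip_if e') ->
  [/\ e = e', eq_level n u u' & eq_level n v v'].
Proof.
move=> E; have ee : e = e'.
  by have := E [:: false] isT; case: e e' {E} => [] [].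
subst e'; split=> // t tn.
  by have := E (e :: t) tn; case: e {E} => -[].
by have := E (~~ e :: t) tn; case: e {E} => -[].
Qed.

End Levels.

(** * Letter counts and powers of the generators *)

Section Generators.
Variables (r : nat) (a : 'I_r -> W).
Hypothesis a_rec : tree_recursion a.

(* The letter a_r occurs nearly equally often in the two coordinates, because
   only a_1^2 = (a_r, a_r) feeds it into the stabilizer of the first level. *)
Lemma wprod_decomposition (s : seq 'I_r) : exists (u v : seq 'I_r) (e : bool),
  [/\ wprod a s = taut_pair (wprod a u) (wprod a v) * flip_if e,
      forall i j : 'I_r, i = j.+1 :> nat ->
        occ i s = (occ j u + occ j v)%N
    & forall i j : 'I_r, i = 0%N :> nat -> j = r.-1 :> nat ->
        occ i s = ((occ j v).*2 + e)%N /\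
        occ j u = (occ j v + e)%N].
Proof.
elim: s => [|k s [u [v [e [IHs IHc IH0]]]]].
  by exists [::], [::], false; split=> //=; rewrite mulg1 taut_pair11.
case: a_rec => a1 a2; case: k => -[|k] k_lt.
  have r_lt : (r.-1 < r)%N by lia.
  (* Here $a_1 (u,v)\sigma^e = (a_r v, u)\sigma^{e+1}$; the exchange of the coordinates keeps the
     counts of $a_r$ balanced. *)
  set l := Ordinal r_lt; exists (l :: v), u, (~~ e); split=> [/=|i j|i j]; rewrite ?occ_cons.
  - rewrite (a1 _ l)// IHs mulgA -(mulgA _ taut_flip) taut_flip_pair mulgA.
    rewrite taut_pairM mul1g -mulgA; congr (_ * _).
    by case: (e) => /=; rewrite ?taut_flip2 ?mulg1.
  - move=> ij; rewrite (IHc i j ij); have := ltn_ord i.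
    by do 2 case: eqP => [/(congr1 val)/=|_]; lia.
  - move=> i0 jr; have [-> cu] := IH0 i j i0 jr.
    have -> : Ordinal k_lt == i by apply/eqP/val_inj; rewrite /= i0.
    have -> : l == j by apply/eqP/val_inj; rewrite /= jr.
    by rewrite cu; case: (e) => /=; lia.
set l := Ordinal (ltnW k_lt); exists (l :: u), v, e; split=> [/=|i j|i j]; rewrite ?occ_cons.
- by rewrite (a2 _ l)// IHs mulgA taut_pairM mul1g.
- move=> ij; rewrite (IHc i j ij); have -> : (Ordinal k_lt == i) = (l == j).
    by apply/eqP/eqP => /(congr1 val) /= H; apply/val_inj => /=; lia.
  by rewrite addnA.
- move=> i0 jr; have [-> cu] := IH0 i j i0 jr.
  case: eqP => [/(congr1 val)/=|_]; first lia.
  by case: eqP => [/(congr1 val)/=|_] //; lia.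
Qed.

(** Descending to the two subtrees costs one level. For [i > 0] the index drops by one and the
    exponent stays. For [i = 0] the index jumps to [r.-1], but the count doubles, so one power of 2
    less is required. The bound $nr+i$ falls by exactly one in both cases. *)
Lemma eq_level_count (L n : nat) (i : 'I_r) (s t : seq 'I_r) :
  (n * r + i <= L)%N -> eq_level L (wprod a s) (wprod a t) ->
  (occ i s = occ i t %[mod 2 ^ n])%N.
Proof.
elim: L n i s t => [|L IH] n i s t; case: n => [|n] nL; rewrite ?modn1//.
  by have := ltn_ord i; nia.
have [u [v [e [-> sc s0]]]] := wprod_decomposition s.
have [u' [v' [e' [-> tc t0]]]] := wprod_decomposition t.
move=> /eq_level_flip[ee uu vv]; subst e'; have := ltn_ord i.
case: (posnP i) => [i0 r_gt|i_gt i_lt].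
  have r_lt : (r.-1 < r)%N by lia.
  have [-> _] := s0 i (Ordinal r_lt) i0 erefl.
  have [-> _] := t0 i (Ordinal r_lt) i0 erefl.
  have : (occ (Ordinal r_lt) v = occ (Ordinal r_lt) v' %[mod 2 ^ n])%N.
    by apply: IH => //=; nia.
  move=> vv'; apply/eqP; rewrite eqn_modDr -!muln2 expnS (mulnC 2).
  by rewrite -!muln_modl vv'.
have j_lt : (i.-1 < r)%N by lia.
have ij : i = (Ordinal j_lt).+1 :> nat by rewrite /=; lia.
rewrite (sc i _ ij) (tc i _ ij) -modnDm.
rewrite (IH n.+1 (Ordinal j_lt) u u')//=; last by lia.
by rewrite (IH n.+1 (Ordinal j_lt) v v') ?modnDm//=; lia.
Qed.

(** From $a_1^2=(a_r,a_r)$ follows $a_1^{2^{n+1}}=(a_r^{2^n},a_r^{2^n})$, and $a_i^k=(a_{i-1}^k,1)$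
    for the other generators, so induction on the level applies. *)
Lemma eq_level_gen_exp2 n i : eq_level n (a i ^+ (2 ^ n)%N) 1.
Proof.
elim: n i => [|n IH] i; first exact: eq_level0.
case: a_rec => a1 a2; rewrite -taut_pair11; have := ltn_ord i.
case: (posnP i) => [i0 r_gt|i_gt i_lt].
  have r_lt : (r.-1 < r)%N by lia.
  rewrite (a1 i (Ordinal r_lt))// expnS expgnA expg2 -mulgA (mulgA taut_flip).
  rewrite taut_flip_pair -(mulgA _ taut_flip) taut_flip2 mulg1 taut_pairM.
  by rewrite mulg1 mul1g taut_pairX; apply: eq_level_pair; exact: IH.
have j_lt : (i.-1 < r)%N by lia.
rewrite (a2 i (Ordinal j_lt)) /=; last by lia.
rewrite taut_pairX expg1n; apply: eq_level_pair => //.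
by rewrite expnSr expgnA -(expg1n _ 2); apply/eq_levelX/IH.
Qed.

Lemma eq_level_gen_exp n k i : (2 ^ n %| k)%N -> eq_level n (a i ^+ k) 1.
Proof.
move=> /dvdnP[m ->]; rewrite mulnC expgnA -(expg1n _ m).
exact/eq_levelX/eq_level_gen_exp2.
Qed.

(** On level [n] the inverse of $a_i$ equals $a_i^{2^n-1}$, so inverses cost no generality. *)
Lemma wprod_inv n s : exists t, eq_level n (wprod a t) (wprod a s)^-1.
Proof.
elim: s => [|i s [t tE]]; first by exists [::]; rewrite /= invg1.
exists (t ++ nseq (2 ^ n)%N.-1 i); rewrite wprod_cat /= invgM.
apply: eq_levelM => //; rewrite wprod_nseq -[X in eq_level _ X]mulg1 -(mulgV (a i)).
rewrite mulgA -expgSr prednK ?expn_gt0// -[X in eq_level _ _ X]mul1g.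
by apply: eq_levelM => //; exact: eq_level_gen_exp2.
Qed.

Lemma generated_wprod (g : W) n : generated_subgroup (range a) g ->
  exists s, eq_level n (wprod a s) g.
Proof.
suff: generated_subgroup (range a) `<=` [set g | exists s, eq_level n (wprod a s) g].
  by apply.
apply: smallest_sub => [|_ [i _ <-]] /=; last by exists [:: i]; rewrite /= mulg1.
split=> [|x y [s sx] [t ty]|x [s sx]] /=; first by exists [::].
- by exists (s ++ t); rewrite wprod_cat; exact: eq_levelM.
- have [t ts] := wprod_inv n s.
  by exists t; apply: eq_level_trans ts _; exact: eq_levelV.
Qed.

(** Density of positive words: an element of the closure agrees on level [n] with one of the
    generated subgroup, whose action there is that of a positive word. *)
Lemma topgen_wprod (g : topgen (range a)) n : exists s, eq_level n (wprod a s) (val g).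
Proof.
have /set_mem /(_ (eq_level n (val g))) := valP g.
case; first by apply/taut_nbhsP; exists n.
move=> h [/(@generated_wprod h n)[s sh] gh]; exists s.
by apply: eq_level_trans sh _; exact: eq_level_sym.
Qed.

End Generators.

(** * Separation, quotients and products of topological groups *)

Section TopologicalGroups.

(** Separation by clopen sets is convenient to carry along: it pulls back along continuous
    injections, passes to products, and yields both the Hausdorff property and total
    disconnectedness. *)
Lemma zero_dimensional_hausdorff (X : topologicalType) :
  zero_dimensional X -> hausdorff_space X.
Proof.
move=> zX p q pq; apply: contrapT => /eqP /zX[U [[oU cU] Up nUq]].
have [] := pq U (~` U).
- by apply: open_nbhs_nbhs.
- by apply: open_nbhs_nbhs; split=> //; exact: closed_openC.
- by move=> x [].
Qed.

Lemma zero_dimensional_inj (X Y : topologicalType) (f : X -> Y) :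
  continuous f -> injective f -> zero_dimensional Y -> zero_dimensional X.
Proof.
move=> fc fI zY x y xy; have /zY[U [cU Ux Uy]] : f x != f y.
  by apply: contra_neq xy => /fI.
by exists (f @^-1` U); split=> //; exact: preimage_clopen.
Qed.

Lemma zero_dimensional_prod (I : Type) (T : I -> topGroupType) :
  (forall i, zero_dimensional (T i)) ->
  zero_dimensional (prod_topology (fun i => T i)).
Proof.
move=> zT x y /eqP xy.
have [i xyi] : exists i, x i <> y i.
  by apply/existsNP => xyE; apply: xy; apply: functional_extensionality_dep.
have /eqP/zT[U [cU Ux Uy]] := xyi.
exists ((fun z : prod_topology (fun i => T i) => z i) @^-1` U); split=> //.
by apply: preimage_clopen => //; exact: prodg_proj_continuous.
Qed.

Lemma compact_hausdorff_inverse (X Y : topologicalType) (f : X -> Y) (f' : Y -> X) :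
  compact [set: X] -> hausdorff_space Y -> continuous f ->
  cancel f f' -> cancel f' f -> continuous f'.
Proof.
move=> cX hY fc fK f'K; apply/continuous_closedP => A cA.
have -> : f' @^-1` A = f @` A.
  apply/seteqP; split=> y /= => [Ay|[x Ax <-]]; last by rewrite fK.
  by exists (f' y).
apply: compact_closed => //; apply: continuous_compact.
  exact: continuous_subspaceT.
exact: (subclosed_compact cA cX).
Qed.

(** The first isomorphism theorem; compactness of the quotient makes the algebraic inverse
    continuous. *)
Lemma quotg_iso (G K : topGroupType) (phi : G -> K) (M : normalSubgroup G) :
  compact [set: G] -> hausdorff_space K ->
  {morph phi : x y / x * y} -> continuous phi -> (forall y, exists x, phi x = y) ->
  (forall x, normal_set M x <-> phi x = 1) ->
  exists f : quotg M -> K,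
    (forall x, f (\pi_(quotg M) x) = phi x) /\ is_top_group_iso f.
Proof.
move=> cG hK phiM phic phiS kerE; pose f (u : quotg M) := phi (repr u).
have fE x : f (\pi_(quotg M) x) = phi x.
  have /kerE := quotg_repr M x; rewrite phiM => E.
  apply: (mulgI (phi x^-1)); rewrite E -phiM mulVg.
  by have [/kerE->] := (normal_setP M).1.
exists f; split=> //.
have fc : continuous f.
  apply/(@quotient_continuous _ _ K f) => /=.
  by have -> : f \o \pi_(quotg M) = phi by exact/funext.
split.
  elim/quotW=> x; elim/quotW=> y.
  by rewrite -quotg_piM !fE phiM.
pose f' y : quotg M := \pi_(quotg M) (projT1 (cid (phiS y))).
have f'K : cancel f' f by move=> y; rewrite fE; case: cid.
have fK : cancel f f'.
  elim/quotW=> x; rewrite fE /f'; case: cid => z /= zE.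
  by apply/quotg_eqP/kerE; rewrite phiM -zE -phiM mulVg; have [/kerE->] := (normal_setP M).1.
exists f'; split=> //; apply: (compact_hausdorff_inverse _ hK fc fK f'K).
have -> : [set: quotg M] = \pi_(quotg M) @` [set: G].
  by apply/seteqP; split=> // u _; exists (repr u) => //; exact: reprK.
apply: continuous_compact => //.
by apply: continuous_subspaceT; exact: quotg_pi_continuous.
Qed.

Lemma prodg_iso (I : Type) (T T' : I -> topGroupType) (f : forall i, T i -> T' i) :
  (forall i, is_top_group_iso (f i)) ->
  is_top_group_iso ((fun x i => f i (x i)) :
    prod_topology (fun i => T i) -> prod_topology (fun i => T' i)).
Proof.
move=> fI; split.
  by move=> x y; apply: functional_extensionality_dep => i; have [+ _] := fI i; apply.
pose f' i := projT1 (cid (fI i).2).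
have f'P i : [/\ cancel (f i) (f' i), cancel (f' i) (f i), continuous (f i)
    & continuous (f' i)] := projT2 (cid (fI i).2).
exists (fun y i => f' i (y i)); split.
- by move=> x; apply: functional_extensionality_dep => i; have [+ _ _ _] := f'P i; apply.
- by move=> x; apply: functional_extensionality_dep => i; have [_ + _ _] := f'P i; apply.
- apply: prodg_continuous => i x; have [_ _ fc _] := f'P i.
  by apply: continuous_comp; [exact: prodg_proj_continuous | exact: fc].
- apply: prodg_continuous => i x; have [_ _ _ fc] := f'P i.
  by apply: continuous_comp; [exact: prodg_proj_continuous | exact: fc].
Qed.

(** This compares $G/N$ with the product of the $G/H^{(i)}$ through $\mathbb{Z}_2^r$; the equation
    on [k] serves to recognize the map induced by the projections. *)
Lemma top_group_iso_comp_inv (G K L : topGroupType) (f : G -> L) (h : K -> L) :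
  is_top_group_iso f -> is_top_group_iso h ->
  exists k : G -> K, (forall x, h (k x) = f x) /\ is_top_group_iso k.
Proof.
move=> [fM [f' [fK f'K fc f'c]]] [hM [h' [hK h'K hc h'c]]].
exists (h' \o f); split=> [x|] /=; first exact: h'K.
split=> [x y|] /=.
  by apply: (can_inj hK); rewrite hM !h'K fM.
exists (f' \o h); split=> [x|x|x|x] /=; rewrite ?h'K ?fK ?f'K ?hK//.
  by apply: continuous_comp; [exact: fc | exact: h'c].
by apply: continuous_comp; [exact: hc | exact: f'c].
Qed.

Lemma quotg_hausdorff_closed (G : topGroupType) (M : normalSubgroup G) :
  hausdorff_space (quotg M) -> closed (M : set G).
Proof.
move=> hM; have -> : (M : set G) = \pi_(quotg M) @^-1` [set \pi_(quotg M) 1].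
  apply/seteqP; split=> x /=.
    by move=> Mx; apply/esym/quotg_eqP; rewrite invg1 mul1g.
  by move=> /esym/quotg_eqP; rewrite invg1 mul1g.
apply: closed_comp; first by move=> x _; exact: quotg_pi_continuous.
exact/accessible_closed_set1/hausdorff_accessible.
Qed.

(** A Hausdorff quotient has a closed kernel, and $(yx)^{-1}(xy)=[x,y]$ lies in it when the quotient
    is commutative. This gives the maximality of the abelian factor group. *)
Lemma commutator_sub_abelian_factor (G : topGroupType) (M : normalSubgroup G) :
  profinite_abelian (quotg M) -> closure (commutator_subgroup G) `<=` M.
Proof.
move=> [[_ hM _] qC]; have /closure_id -> := quotg_hausdorff_closed hM.
apply: closure_subset; apply: smallest_sub; first exact: (normal_setP M).1.
move=> _ [x [y ->]].
have /quotg_eqP : \pi_(quotg M) (y * x) = \pi_(quotg M) (x * y).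
  by rewrite !quotg_piM qC.
by rewrite invgM /commg /conjg !mulgA.
Qed.

End TopologicalGroups.

(** * Compactness and clopen separation in the limit topologies *)

Section LimitTopologies.

Lemma topgen_nbhsP (S : set W) (g : topgen S) (U : set (topgen S)) :
  nbhs g U <-> exists n, forall h, eq_level n (val g) (val h) -> U h.
Proof.
split=> [|[n nU]].
  rewrite nbhsE => -[_ [[B oB <-] Bg] BU].
  have /taut_nbhsP[n nB] : nbhs (val g) B by apply: open_nbhs_nbhs.
  by exists n => h gh; apply: BU; exact: nB.
apply: (@filterS _ _ _ (val @^-1` eq_level n (val g))); first exact: nU.
by apply: (@topgen_val_continuous _ S g); apply/taut_nbhsP; exists n.
Qed.

(** An ultrafilter contains the fibre over [y] or its complement, so candidate values can be
    discarded one at a time. *)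
Lemma ultra_finite_value (X : Type) (Y : eqType) (F : set_system X)
    (f : X -> Y) (s : seq Y) :
  UltraFilter F -> F [set x | f x \in s] -> exists y, F [set x | f x = y].
Proof.
move=> FU; elim: s => [|y s IH] Fs.
  by have [x] := filter_ex Fs.
have [Fy|Fy] := in_ultra_setVsetC [set x | f x = y] FU; first by exists y.
apply: IH; apply: filterS (filterI Fs Fy) => x [] /=.
by rewrite inE => /orP[/eqP|].
Qed.

Lemma ultra_word_value (F : set_system W) (f : W -> word) n :
  UltraFilter F -> (forall u, size (f u) = n) -> exists t, F [set u | f u = t].
Proof.
move=> FU fn; apply: (@ultra_finite_value _ _ F f [seq val t | t : n.-tuple bool]) => //.
apply: filterS filterT => u _ /=; have /eqP fu := fn u.
by apply/mapP; exists (Tuple fu); rewrite ?mem_enum.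
Qed.

Lemma taut_inv_size (u : W) t : size (taut_inv u t) = size t.
Proof. by rewrite -(taut_size u) taut_invK. Qed.

(** An ultrafilter selects one of the finitely many possible images of each vertex; the selected
    images form an automorphism, to which it converges. *)
Lemma taut_compact : compact [set: W].
Proof.
rewrite compact_ultra => F FU _.
have /choice[f fF] t : exists t', F [set u | u t = t'].
  by apply: (ultra_word_value (n := size t)) => u; exact: taut_size.
(* Images under the inverses are selected too; they supply the inverse of the limit. *)
have /choice[f' f'F] t : exists t', F [set u : W | taut_inv u t = t'].
  by apply: (ultra_word_value (n := size t)) => u; exact: taut_inv_size.
have fK : cancel f f'.
  move=> t; have [u /= [<- <-]] := filter_ex (filterI (fF t) (f'F (f t))).
  exact: tautK.
have f'K : cancel f' f.
  move=> t; have [u /= [<- <-]] := filter_ex (filterI (f'F t) (fF (f' t))).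
  exact: taut_invK.
have f0 : f [::] = [::].
  by have [u /= <-] := filter_ex (fF [::]); exact: taut_root.
have fe s t : tree_edge (f s) (f t) <-> tree_edge s t.
  have [u /= [<- <-]] := filter_ex (filterI (fF s) (fF t)); exact: taut_edge.
exists (TreeAut fK f'K f0 fe); split=> // U /taut_nbhsP[n nU].
(* Only finitely many words have length at most [n], so finitely many sets of [F] are
   intersected. *)
have : F [set u : W | forall (k : 'I_n.+1) (t : k.-tuple bool), u t = f t].
  by do 2!apply: filter_forall => ?; exact: fF.
apply: filterS => u uf; apply: nU => t tn.
by rewrite /= (uf (Ordinal (tn : (size t < n.+1)%N)) (in_tuple t)).
Qed.

Lemma topgen_compact (S : set W) : compact [set: topgen S].
Proof.
move=> F FF _.
(* The image filter clusters in [W] at a point of the closed subset, which then lifts to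
   [topgen S]. *)
have [p [clp pF]] : closure (generated_subgroup S) `&` cluster (val @ F) !=set0.
  have cS : compact (closure (generated_subgroup S)).
    by apply: subclosed_compact taut_compact _ => //; exact: closed_closure.
  have vS (x : topgen S) : closure (generated_subgroup S) (val x).
    exact: (set_mem (valP x)).
  by apply: cS; apply: (@filterS _ F _ setT) => [x _|]; [exact: vS | exact: filterT].
exists (exist _ p (mem_set clp)); split=> // B U FB.
move=> /topgen_nbhsP[n nU].
have [] := pF ((val : topgen S -> W) @` B) (eq_level n p).
- by apply: (@filterS _ F _ B) => // x Bx; exists x.
- by apply/taut_nbhsP; exists n.
- by move=> _ [[x Bx <-] px]; exists x; split=> //; exact: nU.
Qed.

Lemma Z2add_zero_dimensional : zero_dimensional Z2add.
Proof.
move=> x y /eqP xy.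
have [n xyn] : exists n, z2 x n <> z2 y n.
  by apply/existsNP => E; apply: xy; exact: z2_inj.
exists (eq_mod n x); split=> //.
(* Unions of residue classes are open; this covers both [eq_mod n x] and its complement. *)
have oE A : (forall u v : Z2add, eq_mod n u v -> A u -> A v) -> open (A : set Z2add).
  by move=> AE; rewrite openE => u Au; apply/z2_nbhsP; exists n => v uv; apply: AE uv Au.
split; first by apply: oE => u v; rewrite /eq_mod => <-.
by rewrite -openC; apply: oE => u v; rewrite /eq_mod /= => ->.
Qed.

End LimitTopologies.

(** * The characters of $G$, their kernels and their joint image *)

Section Characters.
Variables (r : nat) (a : 'I_r -> W).
Hypothesis a_rec : tree_recursion a.
Local Notation G := (topgen (range a)).

Lemma gen_in_topgen i : a i \in closure (generated_subgroup (range a)).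
Proof.
by apply/mem_set/subset_closure; apply: sub_gen_smallest; exists i.
Qed.

Definition topgen_gen i : G := exist _ (a i) (gen_in_topgen i).
Local Notation b := topgen_gen.

Lemma val_wprod s : val (wprod b s) = wprod a s.
Proof. by elim: s => //= i s <-. Qed.

Lemma val_topgenX (g : G) k : val (g ^+ k) = val g ^+ k.
Proof. by elim: k => [|k IH]; rewrite ?expg0// !expgS -IH. Qed.

(* The component of index n is the residue mod 2^(n+1), for which level
   (n+1) r + i <= (n+2) r suffices by [eq_level_count]. *)
Lemma character_exists (i : 'I_r) (g : G) : exists x : Z2, forall n s,
  eq_level (n.+2 * r)%N (wprod a s) (val g) -> z2 x n = (occ i s %% 2 ^ n.+1)%N :> nat.
Proof.
pose w n := projT1 (cid (topgen_wprod a_rec g (n.+2 * r)%N)).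
have wP n : eq_level (n.+2 * r)%N (wprod a (w n)) (val g).
  exact: projT2 (cid (topgen_wprod a_rec g (n.+2 * r)%N)).
have wE n s : eq_level (n.+2 * r)%N (wprod a s) (val g) ->
    (occ i s = occ i (w n) %[mod 2 ^ n.+1])%N.
  move=> sg; apply: (eq_level_count a_rec (L := (n.+2 * r)%N)).
    by have := ltn_ord i; nia.
  exact: eq_level_trans sg (eq_level_sym (wP n)).
pose x n : 'Z_(expn 2 n.+1) := inZp (occ i (w n)).
have xE n : x n = (occ i (w n) %% 2 ^ n.+1)%N :> nat.
  by rewrite /= (Zp_cast (ltn1_exp2 n)).
(* The finer word [w n.+1] approximates [g] on the coarser level as well, so [wE] compares it with
   [w n]. *)
have xP n : (x n.+1 = x n %[mod 2 ^ n.+1])%N.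
  rewrite !xE modn_exp2S modn_mod; apply: wE.
  by apply: eq_level_le (wP n.+1); nia.
by exists (MkZ2 xP) => n s /wE sE; rewrite [LHS]xE sE.
Qed.

(** This is $\chi_i$. Its target is an additive group written multiplicatively, so
    [character i g = 1] means $\chi_i(g)=0$. *)
Definition character i (g : G) : Z2add := projT1 (cid (character_exists i g)).

Lemma characterE i (g : G) n s : eq_level (n.+2 * r)%N (wprod a s) (val g) ->
  z2 (character i g) n = (occ i s %% 2 ^ n.+1)%N :> nat.
Proof. exact: projT2 (cid (character_exists i g)) n s. Qed.

Lemma characterM i : {morph character i : g h / g * h}.
Proof.
move=> g h; apply: z2_inj => n; apply: val_inj => /=.
have [s sg] := topgen_wprod a_rec g (n.+2 * r)%N.
have [t th] := topgen_wprod a_rec h (n.+2 * r)%N.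
have st : eq_level (n.+2 * r)%N (wprod a (s ++ t)) (val (g * h)).
  by rewrite wprod_cat; exact: eq_levelM.
rewrite (characterE i st) [RHS]val_Z2D (characterE i sg) (characterE i th).
by rewrite modnDm /occ count_cat.
Qed.

Lemma character1 i : character i 1 = 1.
Proof. by apply: (mulgI (character i 1)); rewrite -characterM !mulg1. Qed.

Lemma character_gen i j : j != i -> character i (b j) = 1.
Proof.
move=> ji; apply: z2_inj => n; apply: val_inj.
have jE : eq_level (n.+2 * r)%N (wprod a [:: j]) (val (b j)) by rewrite /= mulg1.
by rewrite [LHS](characterE i jE) /occ /= (negPf ji) mod0n.
Qed.

Lemma character_continuous i : continuous (character i).
Proof.
move=> g U /z2_nbhsP[n nU]; apply/topgen_nbhsP; exists (n.+2 * r)%N => h gh.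
apply: nU; apply: val_inj; have [s sg] := topgen_wprod a_rec g (n.+2 * r)%N.
rewrite [LHS](characterE i sg) [RHS](characterE i (s := s))//.
exact: eq_level_trans sg gh.
Qed.

(** Kernels of continuous characters are closed subgroups. The set [J] is a singleton in the
    application to $H^{(i)}$ and contains all indices in that to $[G,G]$. *)
Lemma closure_generated_sub_character_ker (J : set 'I_r) (K : set G) :
  K `<=` [set g | forall i, J i -> character i g = 1] ->
  closure (generated_subgroup K) `<=` [set g | forall i, J i -> character i g = 1].
Proof.
move=> KJ g Kg i Ji; suff: closure (generated_subgroup K) `<=` character i @^-1` [set 1].
  by apply.
have cl : closed (character i @^-1` [set 1]).
  apply: closed_comp; first by move=> x _; exact: character_continuous.
  apply/accessible_closed_set1/hausdorff_accessible/zero_dimensional_hausdorff.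
  exact: Z2add_zero_dimensional.
rewrite [X in _ `<=` X](closure_id _).1//; apply: closure_subset.
apply: smallest_sub => [|x /KJ]; last exact.
split=> /= [|x y xi yi|x xi]; first exact: character1.
- by rewrite characterM xi yi mulg1.
- by apply: (mulgI (character i x)); rewrite -characterM mulgV xi mulg1 character1.
Qed.

Lemma wprod_approx (g : G) n : exists s,
  eq_level n (val (wprod b s)) (val g) /\
  forall i, character i g = 1 -> (2 ^ n %| occ i s)%N.
Proof.
(* The summand [n.+2 * r] makes the counts readable modulo $2^{n+1}$; the summand [n] secures
   agreement on level [n]. *)
have [s sg] := topgen_wprod a_rec g (n.+2 * r + n)%N.
exists s; rewrite val_wprod; split=> [|i gi].
  by apply: eq_level_le sg; exact: leq_addl.
have sg' : eq_level (n.+2 * r)%N (wprod a s) (val g).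
  by apply: eq_level_le sg; exact: leq_addr.
have := characterE i sg'; rewrite gi => /esym/eqP d.
by apply: dvdn_trans d; rewrite dvdn_exp2l.
Qed.

Lemma character_ker (i : 'I_r) :
  closed_normal_closure [set x : G | exists2 j : 'I_r, j != i & val x = a j] =
  [set g | character i g = 1] :> set G.
Proof.
apply/seteqP; split=> g /=.
  move=> Hg; apply: (@closure_generated_sub_character_ker [set i] _ _ g Hg i) => //.
  move=> _ [x [j ji xj] [y ->]] _ /= ->.
  have -> : x = b j by apply: val_inj.
  rewrite /conjg !characterM (character_gen ji) mul1g -characterM mulVg.
  exact: character1.
move=> gi U /topgen_nbhsP[n nU]; have [s [sg /(_ i gi) si]] := wprod_approx g n.
set A := generated_subgroup _; have [[A1 AM AV] AJ] : is_normal_subgroup A.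
  apply: generated_subgroup_normal => z h [x Sx [k ->]].
  by exists x => //; exists (k * h); rewrite conjgM.
(* The letters [i] are collected at the right end: $a_i h=(a_i h a_i^{-1})a_i$, and [A] is normal.
   The resulting power of [b i] is trivial on level [n]. *)
have [h Ah hE] : exists2 h, A h & wprod b s = h * b i ^+ occ i s.
  elim: (s) => [|j t [h Ah hE]] /=; first by exists 1; rewrite ?mulg1.
  rewrite occ_cons hE; case: eqP => [->|/eqP ji].
    by exists (h ^ (b i)^-1); [exact: AJ | rewrite expgS /conjg invgK !mulgA mulgVK].
  exists (b j * h); last by rewrite mulgA.
  apply: AM => //; apply: sub_gen_smallest; exists (b j); first by exists j.
  by exists 1; rewrite conjg1.
exists h; split=> //; apply: nU; apply: eq_level_sym.
apply: (eq_level_trans _ sg); rewrite hE topgen_valM val_topgenX.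
rewrite -[X in eq_level _ X]mulg1; apply: eq_levelM => //.
exact/eq_level_sym/eq_level_gen_exp.
Qed.

Lemma characters_ker :
  closure (commutator_subgroup G) = [set g | forall i, character i g = 1].
Proof.
apply/seteqP; split=> g /=.
  move=> Cg i; apply: (@closure_generated_sub_character_ker setT _ _ g Cg i) => //.
  move=> _ [x [y ->]] j _ /=.
  have E : character j ((y * x) * [~ x, y]) = character j (x * y).
    by rewrite /commg /conjg !mulgA mulgK mulgV mul1g.
  apply: (mulgI (character j (y * x))); rewrite -characterM E mulg1 !characterM.
  by apply: z2_inj => n; exact: GRing.addrC.
move=> gi U /topgen_nbhsP[n nU]; have [s [sg si]] := wprod_approx g n.
have [C1 CM CV] := generated_subgroupP [set z : G | exists x y, z = [~ x, y]].
have [c Cc cs] : exists2 c, commutator_subgroup G c &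
    eq_level n (val c) (val (wprod b s)).
  pose Q t := exists2 c, commutator_subgroup G c &
    eq_level n (val c) (val (wprod b t)).
  (* The property [Q] survives exchanging adjacent blocks, since $yx=[y^{-1},x^{-1}]xy$; hence it
     passes from the sorted word to [s]. *)
  apply: (catCA_perm_ind (P := Q) _ (perm_spread s)) => [s1 s2 s3 [c Cc cE]|].
    pose x := wprod b s1; pose y := wprod b s2.
    exists ([~ y^-1, x^-1] * c).
      by apply: CM => //; apply: sub_gen_smallest; exists y^-1, x^-1.
    have -> : wprod b (s2 ++ s1 ++ s3) = [~ y^-1, x^-1] * wprod b (s1 ++ s2 ++ s3).
      by rewrite !wprod_cat /commg /conjg !invgK -/x -/y !mulgA mulgVK mulgVK.
    by apply: eq_levelM.
  (* Each block of the sorted word is a power with exponent divisible by $2^n$, hence trivial on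
     level [n]. *)
  exists 1 => //; rewrite /spread; elim: (index_enum _) => //= i l IH.
  rewrite wprod_cat wprod_nseq -[1]mulg1; apply: eq_levelM => //.
  by rewrite val_topgenX; apply/eq_level_sym/eq_level_gen_exp/si.
exists c; split=> //; apply: nU; apply: eq_level_sym.
exact: eq_level_trans cs sg.
Qed.

(** A word with suitable counts attains [x] modulo $2^{n+1}$. By compactness these words have a
    cluster point, which attains [x] exactly by continuity. *)
Lemma characters_surjective (x : 'I_r -> Z2add) : exists g, forall i, character i g = x i.
Proof.
pose g n := wprod b (spread (fun i => z2 (x i) n : nat)).
have gE n i : z2 (character i (g n)) n = z2 (x i) n.
  apply: val_inj.
  rewrite /= (characterE i (s := spread (fun i => z2 (x i) n : nat))).
    by rewrite occ_spread modn_small ?ltn_Z2.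
  by rewrite val_wprod.
have [h [_ gh]] := @topgen_compact (range a) (g @ \oo) _ filterT.
exists h => i; apply: z2_inj => n.
have [] := gh [set g m | m in [set m | (n <= m)%N]]
  (character i @^-1` eq_mod n (character i h)).
- by exists n => // m nm; exists m.
- by apply: character_continuous; apply/z2_nbhsP; exists n.
move=> _ [[m nm <-] ->]; exact: eq_mod_le nm (gE m i).
Qed.

End Characters.

(** * The abelianization of $G$ *)

Theorem theorem2p2p7 (r : nat) (r_ge1 : (1 <= r)%N) (a : 'I_r -> W)
    (a_rec : tree_recursion a) :
  let G : topGroupType := topgen (range a) in
  let H (i : 'I_r) : normalSubgroup G :=
    closed_normal_closure [set x : G | exists2 j : 'I_r, j != i & val x = a j] in
  let N : normalSubgroup G := normal_bigcap H in
  let P : topGroupType := prod_topology (fun i : 'I_r => quotg (H i)) in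
  [/\ closure (commutator_subgroup G) = \bigcap_(i : 'I_r) H i,
      is_max_profinite_abelian_factor N,
      exists f : quotg N -> P,
        (forall (x : G) (i : 'I_r), f (\pi_(quotg N) x) i = \pi_(quotg (H i)) x)
        /\ is_top_group_iso f
    & exists h : P -> prod_topology (fun _ : 'I_r => Z2add),
        is_top_group_iso h].
Proof.
move=> G H N P; pose chi := character a_rec.
pose Z : topGroupType := prod_topology (fun _ : 'I_r => Z2add).
have HE i (g : G) : normal_set (H i) g <-> chi i g = 1.
  by have := character_ker a_rec i; rewrite predeqE => /(_ g).
have CN : closure (commutator_subgroup G) = \bigcap_i H i.
  rewrite (characters_ker a_rec); apply/seteqP; split=> g gN i.
    by move=> _; apply/HE; exact: gN.
  by apply/HE; exact: gN.
have cG : compact [set: G] by exact: topgen_compact.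
have zZ : zero_dimensional Z.
  by apply: zero_dimensional_prod => _; exact: Z2add_zero_dimensional.
(* All characters together identify $G/N$ with $\mathbb{Z}_2^r$; below, each single one identifies
   $G/H^{(i)}$ with $\mathbb{Z}_2$. *)
have [F [FE Fiso]] : exists F : quotg N -> Z,
    (forall x, F (\pi_(quotg N) x) = (fun i => chi i x)) /\ is_top_group_iso F.
  apply: quotg_iso => //.
  - exact: zero_dimensional_hausdorff.
  - by move=> x y; apply/funext => i; exact: characterM.
  - by apply: prodg_continuous => i; exact: character_continuous.
  - move=> y; have [g gy] := characters_surjective a_rec y.
    by exists g; apply/funext.
  - move=> x; split=> [Nx|xE i _]; last by apply/HE; exact: (congr1 (@^~ i) xE).
    by apply/funext => i; apply/HE; exact: Nx.
have hP i : exists h : quotg (H i) -> Z2add,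
    (forall x, h (\pi_(quotg (H i)) x) = chi i x) /\ is_top_group_iso h.
  apply: quotg_iso => //.
  - exact/zero_dimensional_hausdorff/Z2add_zero_dimensional.
  - exact: characterM.
  - exact: character_continuous.
  - by move=> y; have [g gy] := characters_surjective a_rec (fun=> y); exists g; exact: gy.
pose h i := projT1 (cid (hP i)).
have hE i : forall x, h i (\pi_(quotg (H i)) x) = chi i x := (projT2 (cid (hP i))).1.
have hiso i : is_top_group_iso (h i) := (projT2 (cid (hP i))).2.
have Piso := prodg_iso hiso.
split; [exact: CN| | |by eexists; exact: Piso].
- split=> [|N' N'ab]; last first.
    by apply: subset_trans (commutator_sub_abelian_factor N'ab); rewrite CN.
  have [FM [F' [FK F'K Fc F'c]]] := Fiso.
  (* Clopen separation is pulled back from $\mathbb{Z}_2^r$, whereas compactness will be inherited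
     from [G]. *)
  have zQ := zero_dimensional_inj Fc (can_inj FK) zZ.
  split; last first.
    move=> x y; apply: (can_inj FK); rewrite !FM.
    apply/funext => i; apply: z2_inj => n; exact: GRing.addrC.
  split; [|exact: zero_dimensional_hausdorff|exact: zero_dimension_totally_disconnected].
  have -> : [set: quotg N] = \pi_(quotg N) @` [set: G].
    by apply/seteqP; split=> // u _; exists (repr u) => //; exact: reprK.
  apply: continuous_compact => //.
  by apply: continuous_subspaceT; exact: quotg_pi_continuous.
- have [f [fE fiso]] := top_group_iso_comp_inv Fiso Piso; exists f; split=> // x i.
  (* Since [h i] is injective, it suffices that both sides have image $\chi_i(x)$ under it. *)
  have [_ [h' [hK _ _ _]]] := hiso i; apply: (can_inj hK).
  by rewrite hE; have := congr1 (@^~ i) (fE (\pi_(quotg N) x)); rewrite FE.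
Qed.
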